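(* Let $\mathcal{F}=\{f_i\}_{i=1}^m\subset L^2(\mathbb{R}^d)$, let $\varphi(\xi)=\sum_{i=1}^m|\widehat f_i(\xi)|^2$, and for $t\ge0$ let $\Omega(t)=\{\xi\in\mathbb{R}^d:\varphi(\xi)>t\}$. For $M>0$ set $t^M=\sup\{t:|\Omega(t)|>M\}$ and $t_M=\inf\{t:|\Omega(t)|<M\}$, and let $\Omega_M\subset\mathbb{R}^d$ be any measurable set of measure $|\Omega_M|=M$ satisfying $$\Omega(t_M)\subset\Omega_M\subset\Omega(t^M).$$ Then $$\min_{E\subset\mathbb{R}^d:\,|E|=M}\ \sum_{i=1}^m\|\widehat f_i(1-\chi_E)\|^2=\sum_{i=1}^m\|\widehat f_i(1-\chi_{\Omega_M})\|^2 .$$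
   Context: $|\cdot|$ denotes Lebesgue measure of a set; $E$ ranges over measurable sets; $\chi_E$ is the characteristic function; $\|\cdot\|$ is the $L^2(\mathbb{R}^d)$ norm. The Fourier transform is $\widehat f(\omega)=\int_{\mathbb{R}^d}f(x)e^{-2\pi i\langle x,\omega\rangle}\,dx$ extended to $L^2(\mathbb{R}^d)$. The supremum and infimum are over $t\in[0,\infty)$, taken in $[0,\infty]$ (so $\sup\emptyset=0$). *)

(* Defs.v *)
From HB Require Import structures.
From mathcomp Require Import all_boot all_order all_algebra.
From mathcomp Require Import all_classical all_reals all_analysis.
From mathcomp.real_closed Require Import complex.

Set Implicit Arguments.
Unset Strict Implicit.
Unset Printing Implicit Defensive.

Import Order.TTheory GRing.Theory Num.Theory.
Import numFieldNormedType.Exports.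

Local Open Scope classical_set_scope.
Local Open Scope ring_scope.

Section borel_lebesgue_measure.
Context {R : realType}.
Let T := measurableTypeR R.

Let cons_pair n (z : T * n.-tuple T) : n.+1.-tuple T := [tuple of z.1 :: z.2].

Let cons_pair_measurable n :
  measurable_fun [set: T * n.-tuple T] (@cons_pair n).
Proof.
apply: (@measurable_cons _ _ _ _ fst n snd).
- exact: measurable_fst.
- exact: measurable_snd.
Qed.

Section step.
Variables (n : nat) (mu : {sigma_finite_measure set (n.-tuple T) -> \bar R}).

Definition cons_measure : set (n.+1.-tuple T) -> \bar R :=
  pushforward (lebesgue_measure \x mu)%E (@cons_pair n).

Let cons_measure0 : cons_measure set0 = 0%E.
Proof. by rewrite /cons_measure /pushforward preimage_set0 measure0. Qed.

Let cons_measure_ge0 A : (0 <= cons_measure A)%E.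
Proof. by rewrite /cons_measure /pushforward; exact: measure_ge0. Qed.

Let cons_measure_sigma_additive : semi_sigma_additive cons_measure.
Proof.
move=> F mF tF mUF; rewrite /cons_measure /pushforward preimage_bigcup.
apply: measure_semi_sigma_additive.
- by move=> k; rewrite -[X in measurable X]setTI; exact: cons_pair_measurable.
- apply/trivIsetP => /= i j _ _ ij; rewrite -preimage_setI.
  by move/trivIsetP : tF => /(_ _ _ _ _ ij) ->//; rewrite preimage_set0.
- rewrite -preimage_bigcup -[X in measurable X]setTI.
  exact: cons_pair_measurable.
Qed.

HB.instance Definition _ := isMeasure.Build _ _ _ cons_measure
  cons_measure0 cons_measure_ge0 cons_measure_sigma_additive.

Let cons_measure_sigma_finite : sigma_finite setT cons_measure.
Proof.
have /sigma_finiteP[F [TF ndF Foo]] := sigma_finiteT (@lebesgue_measure R).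
have /sigma_finiteP[G [TG ndG Goo]] := sigma_finiteT mu.
pose g (t : n.+1.-tuple T) : T * n.-tuple T := (thead t, [tuple of behead t]).
have mg : measurable_fun setT g.
  apply/measurable_fun_pairP; split.
    exact: (@measurable_tnth _ T n.+1 ord0).
  exact: measurable_behead.
have gK : cancel (@cons_pair n) g by case=> x t; congr pair; apply/val_inj.
exists (fun i => g @^-1` (F i `*` G i)).
  rewrite -preimage_bigcup; apply/esym; rewrite -subTset => t _.
  have : setT (g t).1 by []; rewrite TF => -[i _ Fi].
  have : setT (g t).2 by []; rewrite TG => -[j _ Gj].
  exists (maxn i j) => //; split.
    by move: Fi; exact/subsetPset/ndF/leq_maxl.
  by move: Gj; exact/subsetPset/ndG/leq_maxr.
move=> i; have [mF Fi] := Foo i; have [mG Gi] := Goo i; split.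
  by rewrite -[X in measurable X]setTI; apply: mg => //; exact: measurableX.
rewrite /cons_measure /pushforward -comp_preimage.
rewrite (_ : g \o _ = id) ?preimage_id; last by apply/funext => z; exact: gK.
by rewrite product_measure1E// lte_mul_pinfty// ge0_fin_numE.
Qed.

HB.instance Definition _ := Measure_isSigmaFinite.Build _ _ _ cons_measure
  cons_measure_sigma_finite.

End step.

(* the n-fold product of the Lebesgue measure on the Borel sets of R^n *)
Fixpoint borel_lebesgue (n : nat) :
    {sigma_finite_measure set (n.-tuple T) -> \bar R} :=
  if n is n'.+1 then cons_measure (borel_lebesgue n')
  else \d_([tuple] : 0.-tuple T).

Let ocbox n (a b : n.-tuple R) : set (n.-tuple T) :=
  [set x | forall i, tnth a i < tnth x i <= tnth b i].

Let measurable_ocbox n (a b : n.-tuple R) : measurable (ocbox a b).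
Proof.
rewrite (_ : ocbox a b = \bigcap_(i in [set: 'I_n])
    ((fun x : n.-tuple T => tnth x i) @^-1` `]tnth a i, tnth b i]%classic)).
  apply: fin_bigcap_measurable; first exact: finite_finset.
  move=> i _; rewrite -[X in measurable X]setTI.
  by apply: (@measurable_tnth _ T) => //; exact: measurable_itv.
apply/seteqP; split => x /= xab i; first by move=> _ /=; rewrite in_itv/=.
by have := xab i Logic.I; rewrite /= in_itv.
Qed.

Lemma borel_lebesgue_box n (a b : n.-tuple R) :
  (forall i, tnth a i <= tnth b i) ->
  borel_lebesgue n [set x | forall i, tnth a i < tnth x i <= tnth b i] =
  (\prod_(i < n) (tnth b i - tnth a i))%:E.
Proof.
elim: n a b => [|n IH] a b ab.
  by rewrite /= diracE big_ord0 mem_set// => -[].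
rewrite [LHS]/= /cons_measure /pushforward.
pose a' := [tuple of behead a]; pose b' := [tuple of behead b].
have a'E i : tnth a' i = tnth a (lift ord0 i).
  by rewrite [in RHS](tuple_eta a) tnthS.
have b'E i : tnth b' i = tnth b (lift ord0 i).
  by rewrite [in RHS](tuple_eta b) tnthS.
rewrite (_ : _ @^-1` _ = `]tnth a ord0, tnth b ord0]%classic `*` ocbox a' b').
  rewrite product_measure1E//; last exact: measurable_ocbox.
  rewrite IH; last by move=> i; rewrite a'E b'E.
  rewrite /= lebesgue_measure_itv/= lte_fin big_ord_recl EFinM.
  under eq_bigr do rewrite a'E b'E.
  congr *%E; case: ltP => // ba.
  by rewrite (@le_anti _ _ (tnth b ord0) (tnth a ord0)) ?ba ?ab// subrr.
apply/seteqP; split => -[x t] /=.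
  move=> xab; split => [|i] /=; first by rewrite in_itv/=; have := xab ord0.
  by rewrite a'E b'E; have := xab (lift ord0 i); rewrite tnthS.
rewrite in_itv/= => -[x0 tab] i.
by case: (unliftP ord0 i) => [j|] ->; [rewrite tnthS -a'E -b'E; exact: tab|].
Qed.

End borel_lebesgue_measure.

Section fourier_transform.
Context {R : realType} (d : nat).

(* R^d with its Lebesgue (i.e., completed Borel) sigma-algebra *)
Definition euclidean : measurableType _ :=
  caratheodory_type
    ((borel_lebesgue d : set (d.-tuple (measurableTypeR R)) -> \bar R)^*)%mu.

Definition lebesgue : {measure set euclidean -> \bar R} :=
  @completed_measure_extension _ _ R (borel_lebesgue d).

Definition dotp (x y : d.-tuple R) : R := \sum_(i < d) tnth x i * tnth y i.

Implicit Types f g : euclidean -> R[i].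

(* As R[i] carries no sigma-algebra, measurability and integration of
   complex-valued functions are those of their real and imaginary parts. *)
Definition cmeasurable f :=
  measurable_fun setT (fun x => complex.Re (f x)) /\
  measurable_fun setT (fun x => complex.Im (f x)).

Definition cnorm (p : \bar R) f : \bar R :=
  Lnorm lebesgue p (fun x => (Normc.normc (f x))%:E).

(* a predicate on functions, not on their classes modulo a.e. equality *)
Definition Lp (p : \bar R) f := cmeasurable f /\ (cnorm p f < +oo)%E.

Definition cintegral f : R[i] :=
  ((\int[lebesgue]_x complex.Re (f x)) +i*
   (\int[lebesgue]_x complex.Im (f x)))%C.

Definition cexpi (t : R) : R[i] := (cos t +i* sin t)%C.

Definition fourier f (w : euclidean) : R[i] :=
  cintegral (fun x => f x * cexpi (- (2 * pi * dotp x w))).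

(* [g] represents the Fourier transform of [f] in L^2, where the transform
   is the continuous extension of [fourier] from L^1 intersected with L^2. *)
Definition is_fourier f g :=
  [/\ Lp 2 f, Lp 2 g &
  exists u : nat -> euclidean -> R[i],
    [/\ forall n, Lp 1 (u n) /\ Lp 2 (u n),
       cnorm 2 (fun x => u n x - f x) @[n --> \oo] --> 0%E &
       cnorm 2 (fun w => fourier (u n) w - g w) @[n --> \oo] --> 0%E]].

End fourier_transform.

Section superlevel_sets.
Context {R : realType} (d m : nat).
Variable fhat : 'I_m -> euclidean (R := R) d -> R[i].
Local Notation mu := (lebesgue (R := R) d).

Definition phi (xi : euclidean d) : R :=
  \sum_(i < m) (Normc.normc (fhat i xi)) ^+ 2.

Definition Omega (t : \bar R) : set (euclidean d) :=
  [set xi | (t < (phi xi)%:E)%E].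

(* the supremum is taken in [0, +oo], where it is 0 for the empty set *)
Definition tsup (M : R) : \bar R :=
  maxe 0%E (ereal_sup
    [set t%:E | t in [set t : R | 0 <= t /\ (M%:E < mu (Omega t%:E))%E]]).

Definition tinf (M : R) : \bar R :=
  ereal_inf
    [set t%:E | t in [set t : R | 0 <= t /\ (mu (Omega t%:E) < M%:E)%E]].

Definition tail_energy (E : set (euclidean d)) : \bar R :=
  (\sum_(i < m)
     cnorm 2 (fun xi => (fhat i xi * (1 - (\1_E xi)%:C%C))%R) ^+ 2)%E.

End superlevel_sets.

Definition is_minimum {R : realType} (S : set (\bar R)) (x : \bar R) :=
  S x /\ lbound S x.

(* Main.v *)
Require Import Defs.
From HB Require Import structures.
From mathcomp Require Import all_boot all_order all_algebra.
From mathcomp Require Import all_classical all_reals all_analysis.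
From mathcomp Require Import measurable_realfun.
From mathcomp.real_closed Require Import complex.

Set Implicit Arguments.
Unset Strict Implicit.
Unset Printing Implicit Defensive.

Import Order.TTheory GRing.Theory Num.Theory.

Local Open Scope classical_set_scope.
Local Open Scope ring_scope.

(** This is the bathtub principle. By [tail_energyE] the tail energy of [E] is
the integral of [phi] over the complement of [E], so the task is to show that
no set of measure [M] carries more of the integral of [phi] than [OmegaM].

It is enough to find one real threshold [s] such that [phi >= s] almost
everywhere on [OmegaM] and [phi <= s] almost everywhere off it
([threshold_exists]): passing from [OmegaM] to a competitor [E] exchanges
[OmegaM `\` E], where [phi >= s], for [E `\` OmegaM], where [phi <= s], and
these two sets have the same measure ([bathtub]).

When [tinf <= tsup], the threshold is [tsup]. When [tsup < tinf], every level
[s] strictly between the two has a superlevel set of measure exactly [M], by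
the definitions of [tsup] and [tinf]. By continuity from below the set
[Omega tsup] has measure at most [M] as well; since it contains both [OmegaM]
and [Omega s], all three agree up to null sets, and any such [s] is a
threshold. *)

Lemma subset_eq_measure_negligible d (T : measurableType d) (R : realType)
    (mu : {measure set T -> \bar R}) (A B : set T) :
  measurable A -> measurable B -> A `<=` B ->
  mu A \is a fin_num -> (mu B <= mu A)%E -> mu.-negligible (B `\` A).
Proof.
move=> mA mB AB Afin BA; apply/negligibleP; first exact: measurableD.
apply/le_anti; rewrite measure_ge0 andbT -(leeD2rE _ _ Afin) add0e.
apply: le_trans BA; rewrite [leRHS](measureDI mu mB mA).
by rewrite setIC (setIidl AB).
Qed.

Lemma measurable_superlevel d (T : measurableType d) (R : realType)
    (g : T -> R) (t : R) :
  measurable_fun setT g -> measurable [set x | t < g x].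
Proof.
move=> mg; rewrite -[X in measurable X]setTI.
rewrite (_ : [set x | _] = g @^-1` `]t, +oo[%classic); first exact: mg.
by apply/seteqP; split=> x; rewrite /= in_itv/= andbT.
Qed.

(** The set [g > a] is the increasing union of the sets [g > a + 1 / (n + 1)],
so continuity of the measure from below carries a bound on the levels above
[a] over to the level [a] itself. *)
Lemma superlevel_continuous_below d (T : measurableType d) (R : realType)
    (mu : {measure set T -> \bar R}) (g : T -> R) (a : R) (c : \bar R) :
  measurable_fun setT g ->
  (forall t, a < t -> (mu [set x | (t < g x)%R] <= c)%E) ->
  (mu [set x | (a < g x)%R] <= c)%E.
Proof.
move=> mg muc; pose F n := [set x | a + n.+1%:R^-1 < g x].
have mG t : measurable [set x | t < g x] := measurable_superlevel t mg.
have FE : \bigcup_n F n = [set x | a < g x].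
  apply/seteqP; split=> x.
    by move=> [n _]; apply: lt_trans; rewrite ltrDl invr_gt0.
  by move=> /= /ltr_add_invr[n an]; exists n.
have cvF : (mu \o F) n @[n --> \oo] --> mu (\bigcup_n F n).
  apply: nondecreasing_cvg_mu; [by move=> n; exact: mG|by rewrite FE|].
  move=> n m nm; apply/subsetPset => x; apply: le_lt_trans.
  by rewrite lerD2l lef_pV2 ?posrE// ler_nat.
rewrite -FE; apply: cvge_le cvF.
by apply: nearW => n; apply: muc; rewrite ltrDl invr_gt0.
Qed.

Lemma exists_real_between (R : realType) (a b : \bar R) :
  (0 <= a)%E -> (a < b)%E -> exists2 s : R, (a < s%:E)%E & (s%:E < b)%E.
Proof.
case: a b => [a| |] [b| |]//= _.
- rewrite lte_fin => ab; exists ((a + b) / 2);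
  by rewrite lte_fin ?(midf_lt ab).
- by move=> _; exists (a + 1); rewrite ?ltry// lte_fin ltrDl.
Qed.

(** Here [a] and [b] stand for [tsup] and [tinf]. The threshold holds only almost everywhere because, for
[a < b], the set [O] is squeezed between superlevel sets that differ by null
sets. *)
Lemma threshold_exists d (T : measurableType d) (R : realType)
    (mu : {measure set T -> \bar R}) (g : T -> R) (M : R) (a b : \bar R)
    (O : set T) :
  measurable_fun setT g -> 0 < M -> (0 <= a)%E ->
  (forall t, 0 <= t -> (M%:E < mu [set x | (t < g x)%R])%E -> (t%:E <= a)%E) ->
  (forall t, 0 <= t -> (mu [set x | (t < g x)%R] < M%:E)%E -> (b <= t%:E)%E) ->
  measurable O -> mu O = M%:E ->
  [set x | (b < (g x)%:E)%E] `<=` O -> O `<=` [set x | (a < (g x)%:E)%E] ->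
  exists s : R, [/\ 0 <= s, {ae mu, forall x, O x -> s <= g x} &
    {ae mu, forall x, ~ O x -> g x <= s}].
Proof.
move=> mg M0 a0 ha hb mO muO bO Oa.
have mG t : measurable [set x | t < g x] := measurable_superlevel t mg.
have [ab|ba] := ltP a b; last first.
  (* Here [a] itself is the threshold; it is finite since [O], of positive
     measure, would otherwise be empty. *)
  case: a a0 ha Oa ba => [s| |]// s0 _ Oa bs; last first.
    have O0 : O = set0 by apply/seteqP; split=> // x /Oa.
    by move: muO; rewrite O0 measure0 => -[M0']; rewrite -M0' ltxx in M0.
  exists s; split=> //; apply: aeW => x /=; first by move=> /Oa /= /ltW.
  by apply: contra_notT; rewrite -ltNge => sg; apply: bO; exact: le_lt_trans bs _.
have [s as_ sb] := exists_real_between a0 ab.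
have s0 : 0 <= s by rewrite -lee_fin (le_trans a0)// ltW.
have mus : mu [set x | (s < g x)%R] = M%:E.
  apply/le_anti/andP; split; rewrite leNgt.
    by apply/negP => /(ha _ s0); rewrite leNgt as_.
  by apply/negP => /(hb _ s0); rewrite leNgt sb.
case: a a0 ha Oa ab as_ => [a| |]// a0 ha Oa ab as_.
have mua : (mu [set x | (a < g x)%R] <= M%:E)%E.
  apply: superlevel_continuous_below => // t at_; rewrite leNgt; apply/negP.
  have t0 : 0 <= t by rewrite (le_trans _ (ltW at_)).
  by move=> /(ha _ t0); rewrite lee_fin leNgt at_.
have as' : [set x | s < g x] `<=` [set x | a < g x].
  by move=> x; exact: lt_trans.
have Oa' : O `<=` [set x | a < g x] by [].
exists s; split=> //.
- have := subset_eq_measure_negligible (mu := mu) (mG s) (mG a) as'.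
  rewrite mus => /(_ isT mua); apply: negligibleS => x /= /not_implyP[Ox /negP].
  by rewrite -ltNge => /ltW gs; split; [exact: Oa'|apply/negP; rewrite -leNgt].
- have := subset_eq_measure_negligible (mu := mu) mO (mG a) Oa'.
  rewrite muO => /(_ isT mua); apply: negligibleS => x /= /not_implyP[Ox /negP].
  by rewrite -ltNge => sg; split=> //; exact: as'.
Qed.

(** Both integrals share the part over the complement of [O `|` E]; what is
left compares [E `\` O], where [g] is at most [s], with [O `\` E], where it is
at least [s]. The two differences have equal measure because [O] and [E] do and
their intersection has finite measure. *)
Lemma bathtub d (T : measurableType d) (R : realType)
    (mu : {measure set T -> \bar R}) (g : T -> R) (s : R) (O E : set T) :
  measurable_fun setT g -> (forall x, 0 <= g x) -> 0 <= s ->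
  measurable O -> measurable E -> mu O \is a fin_num -> mu E = mu O ->
  {ae mu, forall x, O x -> s <= g x} ->
  {ae mu, forall x, ~ O x -> g x <= s} ->
  (\int[mu]_(x in ~` O) (g x)%:E <= \int[mu]_(x in ~` E) (g x)%:E)%E.
Proof.
move=> mg g0 s0 mO mE Ofin EO sO Os.
have mgE D : measurable_fun D (EFin \o g).
  by apply/measurable_EFinP; exact: measurable_funTS.
have split_compl (A B : set T) : measurable A -> measurable B ->
    (\int[mu]_(x in ~` A) (g x)%:E = \int[mu]_(x in ~` A `&` ~` B) (g x)%:E +
      \int[mu]_(x in B `\` A) (g x)%:E)%E.
  move=> mA mB; rewrite -ge0_integral_setU//.
  - by rewrite [B `\` A]setDE [B `&` _]setIC -setIUr setUC setUv setIT.
  - by apply: measurableI; exact: measurableC.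
  - exact: measurableD.
  - by move=> x _; rewrite lee_fin.
  - by apply/disj_setPS => x [[_ nB] [/nB]].
rewrite (split_compl O E)// (split_compl E O)// [~` E `&` _]setIC leeD2l//.
have DE : mu (E `\` O) = mu (O `\` E).
  have Ifin : mu (O `&` E) \is a fin_num.
    rewrite ge0_fin_numE//; apply: le_lt_trans (_ : mu O < +oo)%E.
      by apply: le_measure; rewrite ?inE//; exact: measurableI.
    by rewrite -ge0_fin_numE.
  rewrite -[LHS](addeK _ Ifin) -[RHS](addeK _ Ifin) -(measureDI mu mO mE).
  by rewrite (setIC O) -(measureDI mu mE mO); congr (_ - _)%E.
apply: (@le_trans _ _ (s%:E * mu (E `\` O))%E).
  rewrite -integral_cst; last exact: measurableD.
  apply: ae_ge0_le_integral => //; first exact: measurableD.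
  - by move=> x _; rewrite lee_fin.
  - by apply: filterS Os => x + [_ nO]; rewrite lee_fin; apply.
rewrite DE -integral_cst; last exact: measurableD.
apply: ae_ge0_le_integral => //; first exact: measurableD.
- by move=> x _; rewrite lee_fin.
- by apply: filterS sO => x + [Ox _]; rewrite lee_fin; apply.
Qed.

Lemma normc_sqr (R : rcfType) (z : R[i]) :
  Normc.normc z ^+ 2 = complex.Re z ^+ 2 + complex.Im z ^+ 2.
Proof. by case: z => a b /=; rewrite sqr_sqrtr// addr_ge0// sqr_ge0. Qed.

Lemma measurable_normc_sqr (R : realType) d (h : @euclidean R d -> R[i]) :
  cmeasurable h -> measurable_fun setT (fun x => Normc.normc (h x) ^+ 2).
Proof.
move=> [mRe mIm]; under eq_fun do rewrite normc_sqr.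
by apply: measurable_funD; exact: measurable_funX.
Qed.

Lemma cnorm2_sqr (R : realType) d (h : @euclidean R d -> R[i]) :
  (cnorm 2 h ^+ 2 = \int[lebesgue d]_x (Normc.normc (h x) ^+ 2)%:E)%E.
Proof.
rewrite /cnorm unlock poweR12_sqrt ?sqr_sqrte; last 2 first.
  - by apply: integral_ge0 => x _; exact: poweR_ge0.
  - by apply: integral_ge0 => x _; exact: poweR_ge0.
apply: eq_integral => x _; rewrite abse_EFin poweR_EFin powR_mulrn//.
by rewrite real_normK// num_real.
Qed.

(** Multiplying by [1 - \1_E] restricts each squared norm to the complement of
[E], and the finite sum over the components commutes with the integral. *)
Lemma tail_energyE (R : realType) (d m : nat)
    (fhat : 'I_m -> @euclidean R d -> R[i]) (E : set (@euclidean R d)) :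
  (forall i, cmeasurable (fhat i)) -> measurable E ->
  tail_energy fhat E = (\int[lebesgue d]_(x in ~` E) (phi fhat x)%:E)%E.
Proof.
move=> mf mE; rewrite /tail_energy.
under [RHS]eq_integral do rewrite /phi -sumEFin.
rewrite ge0_integral_sum//; last 3 first.
- exact: measurableC.
- move=> i; apply/measurable_EFinP; apply: measurable_funTS.
  exact: measurable_normc_sqr.
- by move=> i x _; rewrite lee_fin sqr_ge0.
apply: eq_bigr => i _; rewrite cnorm2_sqr [RHS]integral_mkcond.
apply: eq_integral => x _; rewrite patchE indicE in_setC.
case: (x \in E) => /=.
  by rewrite subrr mulr0 Normc.normc0 expr0n.
by rewrite subr0 mulr1.
Qed.

Lemma measurable_phi (R : realType) (d m : nat)
    (fhat : 'I_m -> @euclidean R d -> R[i]) :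
  (forall i, cmeasurable (fhat i)) -> measurable_fun setT (phi fhat).
Proof.
move=> mf; apply: measurable_sum => i.
exact: measurable_normc_sqr.
Qed.

Theorem theorem12 (R : realType) (d m : nat)
    (f fhat : 'I_m -> @euclidean R d -> R[i])
    (hL2 : forall i, Lp 2 (f i))
    (hfhat : forall i, is_fourier (f i) (fhat i))
    (M : R) (M_gt0 : 0 < M)
    (OmegaM : set (@euclidean R d))
    (mOmegaM : measurable OmegaM)
    (muOmegaM : lebesgue d OmegaM = M%:E)
    (lower : Omega fhat (tinf fhat M) `<=` OmegaM)
    (upper : OmegaM `<=` Omega fhat (tsup fhat M)) :
  is_minimum
    [set tail_energy fhat E | E in [set E | measurable E /\ lebesgue d E = M%:E]]
    (tail_energy fhat OmegaM).
Proof.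
have mfhat i : cmeasurable (fhat i) by have [_ []] := hfhat i.
have mphi := measurable_phi mfhat.
have phi0 x : 0 <= phi fhat x by apply: sumr_ge0 => i _; exact: sqr_ge0.
split; first by exists OmegaM.
move=> _ [E [mE muE] <-]; rewrite !tail_energyE//.
have [|||s [s0 sO Os]] := @threshold_exists _ _ _ (lebesgue d) (phi fhat) M
    (tsup fhat M) (tinf fhat M) OmegaM mphi M_gt0 _ _ _ mOmegaM muOmegaM lower upper.
- by rewrite /tsup le_max lexx.
- move=> t t0 Mt; rewrite /tsup le_max; apply/orP; right.
  by apply: ereal_sup_ubound; exists t.
- by move=> t t0 tM; apply: ereal_inf_lbound; exists t.
by apply: (bathtub mphi phi0 s0) => //; rewrite ?muOmegaM.
Qed.
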